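(* Let $L$ be an oriented link in $S^3$ represented by a connected oriented planar diagram $P_L$, fix a choice of two adjacent starred regions of $P_L$, and let $\mathcal{S}$ be the set of all resulting states. Then the white-hole state sum $\Theta_L(t)$ (the version of the Alexander polynomial given by Ozsváth and Szabó) and the black-hole state sum $\nabla_L(t)$ (the Formal Knot Theory state sum of Kauffman) are equal; that is, $$\Theta_L(t)=\sum_{S\in\mathcal{S}}(-1)^{\sharp W_S}\,[L|S]\;=\;\sum_{S\in\mathcal{S}}(-1)^{\sharp B_S}\,\langle L|S\rangle=\nabla_L(t).$$
   Context: Setting. $P_L$ is an oriented planar diagram of the oriented link $L$, assumed connected, with crossings $v_1,\dots,v_n$. It divides the plane into $n+2$ regions (one unbounded). Two regions are adjacent if they share an edge of the diagram. Choose two adjacent regions and mark each with a star. A state $S$ (FKT state, Kauffman state) is an assignment, to each crossing $v_i$, of a marker placed in one of the four local corners at $v_i$ belonging to an unstarred region, such that no region contains more than one marker. $\mathcal{S}$ is the set of all states for the fixed choice of stars. Black and white holes. A marker at a crossing is a black hole if it lies in the corner between the two ingoing strands at that crossing, and a white hole if it lies in the corner between the two outgoing strands. $B_S$ (resp. $W_S$) is the set of markers of $S$ that are black (resp. white) holes, and $\sharp$ denotes cardinality. Labels. Crossings have the usual sign (positive or negative) determined by the orientation and the over/under information. The label of a corner at a crossing is given as follows. Labels for $\langle\cdot|\cdot\rangle$ (Alexander-Conway labels): at a positive crossing, the corner between the outgoing strands has label $t^{1/2}$, the corner between the ingoing strands has label $t^{-1/2}$, and the other two corners have label $1$; at a negative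 crossing, the corner between the outgoing strands has label $t^{-1/2}$, the corner between the ingoing strands has label $t^{1/2}$, and the other two corners have label $1$. Labels for $[\cdot|\cdot]$: the inverses of the Alexander-Conway labels used for $\langle\cdot|\cdot\rangle$, i.e. the labels at a positive (negative) crossing are those used in $\langle\cdot|\cdot\rangle$ at a negative (positive) crossing. For a state $S$, $\langle L|S\rangle$ (resp. $[L|S]$) is the product over all crossings of the corresponding label of the corner occupied by the marker of $S$. State sums. $\nabla_L(t)=\sum_{S\in\mathcal{S}}(-1)^{\sharp B_S}\langle L|S\rangle$ and $\Theta_L(t)=\sum_{S\in\mathcal{S}}(-1)^{\sharp W_S}[L|S]$, as elements of $\mathbb{Z}[t^{1/2},t^{-1/2}]$. It is a known theorem of Kauffman that $\nabla_L(t)$ is the Alexander-Conway polynomial of $L$: it is an invariant of oriented links with $\nabla_{\bigcirc}(t)=1$ and $\nabla_{L_+}(t)-\nabla_{L_-}(t)=(t^{1/2}-t^{-1/2})\nabla_{L_0}(t)$, where $L_+,L_-,L_0$ are identical except near one crossing, where they have a positive crossing, a negative crossing and the oriented smoothing respectively. *)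

(* Defs.v *)
From HB Require Import structures.
From mathcomp Require Import all_boot all_order all_algebra.

Set Implicit Arguments.
Unset Strict Implicit.
Unset Printing Implicit Defensive.

Import GRing.Theory.
Local Open Scope ring_scope.

(* Near a crossing both strands are drawn pointing upwards, so that one enters
   from the lower left and leaves to the upper right, and the other enters from
   the lower right and leaves to the upper left. *)

Inductive hand := Left | Right.

Definition bool_of_hand (h : hand) : bool := if h is Left then true else false.
Definition hand_of_bool (b : bool) : hand := if b then Left else Right.
Lemma bool_of_handK : cancel bool_of_hand hand_of_bool. Proof. by case. Qed.
HB.instance Definition _ := Finite.copy hand (can_type bool_of_handK).

Definition opp_hand (h : hand) : hand := if h is Left then Right else Left.

Inductive corner := OutCorner | InCorner | LeftCorner | RightCorner.

Definition bools_of_corner (c : corner) : bool * bool :=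
  match c with
  | OutCorner => (true, true)
  | InCorner => (true, false)
  | LeftCorner => (false, true)
  | RightCorner => (false, false)
  end.
Definition corner_of_bools (b : bool * bool) : corner :=
  match b with
  | (true, true) => OutCorner
  | (true, false) => InCorner
  | (false, true) => LeftCorner
  | (false, false) => RightCorner
  end.
Lemma bools_of_cornerK : cancel bools_of_corner corner_of_bools.
Proof. by case. Qed.
HB.instance Definition _ := Finite.copy corner (can_type bools_of_cornerK).

(* An oriented link diagram as a combinatorial map on an oriented surface.
   [in_edge (v, h)] is the edge entering the crossing [v] from its lower [h],
   [out_edge (v, h)] the edge leaving [v] to its upper [h].  By injectivity and
   [in_out_edge], an edge either runs from exactly one outgoing end to exactly
   one ingoing end, or meets no crossing at all; in the latter case it is a
   crossingless circle.  [over v] tells from which side the over-strand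
   enters [v]. *)
Record link_diagram := LinkDiagram {
  crossing : finType;
  edge : finType;
  in_edge : crossing * hand -> edge;
  out_edge : crossing * hand -> edge;
  over : crossing -> hand;
  in_edge_inj : injective in_edge;
  out_edge_inj : injective out_edge;
  in_out_edge : codom in_edge =i codom out_edge
}.

Section Diagram.
Variable D : link_diagram.
Implicit Types (v : crossing D) (e : edge D).

(* The over-strand from lower left to upper right crosses the under-strand
   from right to left: this is the positive crossing. *)
Definition positive v : bool := over v == Left.

Definition incident v e : bool :=
  [exists h, (e == in_edge (v, h)) || (e == out_edge (v, h))].

Definition edges_meet : rel (edge D) :=
  [rel e f | [exists v, incident v e && incident v f]].

Definition diagram_connected : Prop := forall e f, connect edges_meet e f.

(* [(e, h)] is the side of the edge [e] lying to the [h] of a traveller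
   following the orientation of [e]. *)
Definition edge_side : finType := (edge D * hand)%type.

Definition corner_sides v (c : corner) : edge_side * edge_side :=
  match c with
  | OutCorner => ((out_edge (v, Left), Right), (out_edge (v, Right), Left))
  | InCorner => ((in_edge (v, Left), Right), (in_edge (v, Right), Left))
  | LeftCorner => ((in_edge (v, Left), Left), (out_edge (v, Left), Left))
  | RightCorner => ((in_edge (v, Right), Right), (out_edge (v, Right), Right))
  end.

Definition share_corner : rel edge_side :=
  [rel s1 s2 | [exists v, [exists c,
    (corner_sides v c == (s1, s2)) || (corner_sides v c == (s2, s1))]]].

(* A region is identified with the set of edge sides on its boundary; in a
   connected diagram this boundary is a single closed walk turning at
   corners. *)
Definition region_of (s : edge_side) : {set edge_side} :=
  [set s' | connect share_corner s s'].

Definition regions : {set {set edge_side}} := [set region_of s | s : edge_side].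

(* Euler's formula V - E + F = 2: the surface carrying a connected diagram with
   n > 0 crossings (hence 2n edges) is the sphere iff there are n + 2 regions.
   The crossingless circle also has 0 + 2 regions. *)
Definition diagram_planar : Prop := #|regions| = (#|crossing D| + 2)%N.

Definition regions_adjacent (R1 R2 : {set edge_side}) : Prop :=
  [/\ R1 \in regions, R2 \in regions, R1 != R2
    & exists e h, (e, h) \in R1 /\ (e, opp_hand h) \in R2].

Definition corner_region v (c : corner) : {set edge_side} :=
  region_of (corner_sides v c).1.

Definition marker_region (S : {ffun crossing D -> corner}) v : {set edge_side} :=
  corner_region v (S v).

Definition states (R1 R2 : {set edge_side}) : {set {ffun crossing D -> corner}} :=
  [set S | [forall v, (marker_region S v != R1) && (marker_region S v != R2)]
           && injectiveb (marker_region S)].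

Definition black_holes (S : {ffun crossing D -> corner}) : {set crossing D} :=
  [set v | S v == InCorner].
Definition white_holes (S : {ffun crossing D -> corner}) : {set crossing D} :=
  [set v | S v == OutCorner].

(* Z[t^(1/2), t^(-1/2)] is viewed inside the fraction field of Z[X], where
   X = t^(1/2). *)
Definition sqrt_t : {fraction {poly int}} := tofrac 'X.

Definition ac_label v (c : corner) : {fraction {poly int}} :=
  match c with
  | OutCorner => if positive v then sqrt_t else sqrt_t^-1
  | InCorner => if positive v then sqrt_t^-1 else sqrt_t
  | LeftCorner | RightCorner => 1
  end.

Definition os_label v (c : corner) : {fraction {poly int}} := (ac_label v c)^-1.

Definition ac_weight (S : {ffun crossing D -> corner}) : {fraction {poly int}} :=
  \prod_v ac_label v (S v).
Definition os_weight (S : {ffun crossing D -> corner}) : {fraction {poly int}} :=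
  \prod_v os_label v (S v).

Definition nabla (R1 R2 : {set edge_side}) : {fraction {poly int}} :=
  \sum_(S in states R1 R2) (-1) ^+ #|black_holes S| * ac_weight S.
Definition Theta (R1 R2 : {set edge_side}) : {fraction {poly int}} :=
  \sum_(S in states R1 R2) (-1) ^+ #|white_holes S| * os_weight S.

End Diagram.

(* Main.v *)
Require Import Defs.
From HB Require Import structures.
From mathcomp Require Import all_boot all_order all_algebra.
From mathcomp Require Import all_fingroup ring zify.

Set Implicit Arguments.
Unset Strict Implicit.
Unset Printing Implicit Defensive.

Import GRing.Theory.
Local Open Scope ring_scope.

(** Both state sums are determinants, and the two determinants are related by
    a skew-symmetry that only uses that every edge has one tail and one head.

    Fix one state S0, and use it to index the unstarred regions by the
    crossings.  A state S is then a permutation of the crossings, and its sign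
    is (-1)^(number of black holes), up to a factor that depends on S0 only
    ([black_holes_perm]).  Hence nabla is, up to that factor, the determinant of
    the matrix M(a, b) with one row per crossing v and one column per unstarred
    region, in which the outgoing corner of v contributes a v, the ingoing one
    b v, and the two others 1 ([det_state_matrix]).  The weights of Theta are
    those of nabla with a and b exchanged.

    Let A be the matrix of outgoing minus ingoing corners.  Then M(a, b) -
    M(b, a) = diag(a - b) A, and if a + b is constant, as for the labels
    t^(1/2) and t^(-1/2), then A^T M(b, a) = - M(a, b)^T A: expanded, this
    compares a sum over the heads of all edges with a sum over their tails.
    These two relations imply det M(b, a) = (-1)^(rank A) det M(a, b)
    ([det_skew_partner]); when A is invertible the second one is enough, and in
    general a change of bases makes A diagonal and both matrices block
    triangular.  With a = 1 and b = -1 all the terms of one determinant have the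
    same sign, which forces (-1)^(white holes + black holes) = (-1)^(rank A) for
    every state ([hole_parity]).  The theorem follows.

    The sign of a state is where the sphere is needed.  The crossings and the
    regions, joined by the corners, form a graph on the sphere in which every
    edge of the diagram is a quadrilateral face.  Giving the ingoing corners the
    sign -1 makes the product of the signs around each face -1, so that the sign
    rule is Kasteleyn's theorem.  Two states differ along disjoint cycles of this
    graph, one for each orbit of the corresponding permutation on which they use
    different corners.  Each cycle through k crossings bounds a set of F faces, the side that does not
    contain an edge between the two starred regions; it encloses as many
    crossings as regions, since the first state matches them, and Euler's formula
    gives F = k - 1 modulo 2 ([orbit_black_holes]).  Euler's formula for one side
    is obtained from linear algebra over the field with two elements: boundaries
    and coboundaries are orthogonal, which bounds the sum of their ranks on either
    side of the cycle ([inside_bound]); the two bounds add up to an equality. *)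

(** * Determinants and orthogonality *)

(** In blocks, the first relation says that the top left blocks of [P] and [Q]
    are opposite transposes and that both matrices are block lower triangular;
    the second one says that their bottom right blocks agree. *)
Lemma det_skew_partner_pid (K : fieldType) r m (P Q X : 'M[K]_(r + m)) :
  pid_mx r *m Q = - (P^T *m pid_mx r) -> P - Q = X *m pid_mx r ->
  \det Q = (-1) ^+ r * \det P.
Proof.
rewrite -[P]submxK -[Q]submxK -[X]submxK !tr_block_mx pid_mx_block.
rewrite !mulmx_block !opp_block_mx !add_block_mx.
rewrite !(mul1mx, mul0mx, mulmx1, mulmx0, addr0, oppr0).
move=> /eq_block_mx [eul eur edl _] /eq_block_mx [_ _ _ edr].
have Pur0 : ursubmx P = 0.
  by apply: trmx_inj; apply: oppr_inj; rewrite trmx0 oppr0 -edl.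
rewrite eul eur Pur0 !det_lblock mulrA -det_tr linearN /= trmxK -scaleN1r detZ.
by move/eqP: edr; rewrite subr_eq0 => /eqP ->.
Qed.

(** Writing A = L *m pid_mx r *m R, multiplication by L^T on the left and by
    R^-1 on the right preserves both relations and replaces [A] by [pid_mx r].  For
    invertible [A] the first relation alone is enough; the second one controls
    the part of [P] and [Q] that [A] does not see. *)
Lemma det_skew_partner (K : fieldType) n (A P Q X : 'M[K]_n) :
  A^T *m Q = - (P^T *m A) -> P - Q = X *m A ->
  \det Q = (-1) ^+ \rank A * \det P.
Proof.
move=> skew diff; set r := \rank A.
pose L := col_ebase A; pose R := row_ebase A.
have LU : L \in unitmx by apply: col_ebase_unit.
have RU : R \in unitmx by apply: row_ebase_unit.
have defA : A = L *m pid_mx r *m R by rewrite mulmx_ebase.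
pose P1 := L^T *m P *m invmx R; pose Q1 := L^T *m Q *m invmx R.
have skew1 : pid_mx r *m Q1 = - (P1^T *m pid_mx r).
  have RtU : R^T \in unitmx by rewrite unitmx_tr.
  apply: (can_inj (mulKmx RtU)); apply: (can_inj (mulmxK RU)).
  have <- : A^T *m Q = R^T *m (pid_mx r *m Q1) *m R.
    by rewrite /Q1 !mulmxA mulmxKV // defA !trmx_mul tr_pid_mx !mulmxA.
  rewrite skew /P1 !trmx_mul trmxK trmx_inv mulmxN mulNmx !mulmxA mulmxV //.
  by rewrite mul1mx {1}defA !mulmxA.
have diff1 : P1 - Q1 = (L^T *m X *m L) *m pid_mx r.
  apply: (can_inj (mulmxK RU)).
  by rewrite mulmxBl /P1 /Q1 !mulmxKV // -mulmxBr diff {1}defA !mulmxA.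
have main : \det Q1 = (-1) ^+ r * \det P1.
  have ler : (r <= n)%N by apply: rank_leq_row.
  move: P1 Q1 (L^T *m X *m L) skew1 diff1; clearbody r; clear -ler.
  by rewrite -(subnKC ler) => P1 Q1 X; apply: det_skew_partner_pid.
move: main; rewrite !det_mulmx !mulrA => /mulIf.
rewrite det_inv invr_eq0 -unitfE -unitmxE => /(_ RU).
rewrite det_tr ![_ * \det L]mulrC -mulrA => /mulfI -> //.
by rewrite -unitfE -unitmxE.
Qed.

(** This replaces the homology computations: restricted to the coordinates in
    [C], two independent and mutually orthogonal families have at most #|C|
    vectors in total.  Families indexed by subsets of finite types spare all
    re-indexing of chains by ordinals. *)
Lemma orthogonal_families (K : fieldType) (F V E : finType) (A : {set F})
    (B : {set V}) (C : {set E}) (a : F -> E -> K) (b : V -> E -> K) :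
  (forall f v, f \in A -> v \in B -> \sum_(e in C) a f e * b v e = 0) ->
  (forall phi : F -> K, (forall f, f \notin A -> phi f = 0) ->
     (forall e, e \in C -> \sum_f phi f * a f e = 0) -> forall f, phi f = 0) ->
  (forall g : V -> K, (forall v, v \notin B -> g v = 0) ->
     (forall e, e \in C -> \sum_v g v * b v e = 0) -> forall v, g v = 0) ->
  (#|A| + #|B| <= #|C|)%N.
Proof.
move=> orth freeA freeB.
have free (W : finType) (Y : {set W}) (d : W -> E -> K) :
    (forall phi : W -> K, (forall f, f \notin Y -> phi f = 0) ->
     (forall e, e \in C -> \sum_f phi f * d f e = 0) -> forall f, phi f = 0) ->
    row_free (\matrix_(i < #|Y|, j < #|C|) d (enum_val i) (enum_val j)).
  move=> freeY; apply: inj_row_free => u u0.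
  pose phi f := \sum_(i < #|Y|) u 0 i * (enum_val i == f)%:R.
  have phiE i : phi (enum_val i) = u 0 i.
    rewrite /phi (bigD1 i) //= eqxx mulr1 big1 ?addr0 // => j ji.
    by rewrite (inj_eq enum_val_inj) (negPf ji) mulr0.
  apply/rowP => i; rewrite mxE -phiE; apply: freeY => [f fY | e eC].
    rewrite /phi big1 // => j _; case: eqP => [jf | _]; last by rewrite mulr0.
    by rewrite -jf enum_valP in fY.
  move/rowP/(_ (enum_rank_in eC e)): u0; rewrite !mxE => u0; rewrite -[RHS]u0.
  transitivity (\sum_(f in Y) phi f * d f e).
    rewrite [LHS](bigID (mem Y)) /= [X in _ + X]big1 ?addr0 // => f fY.
    rewrite /phi big1 ?mul0r // => j _; case: eqP => [jf | _]; last by rewrite mulr0.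
    by rewrite -jf enum_valP in fY.
  transitivity (\sum_(j < #|Y|) phi (enum_val j) * d (enum_val j) e).
    exact: (big_enum_val (fun f => phi f * d f e)).
  by apply: eq_bigr => j _; rewrite phiE mxE enum_rankK_in.
have MA := free _ _ _ freeA; have MB := free _ _ _ freeB.
move: MB; rewrite -row_leq_rank -mxrank_tr => MB.
move: MA; rewrite -row_leq_rank => MA.
apply: leq_trans (leq_add MA MB) _; apply: mulmx0_rank_max.
apply/matrixP => i j; rewrite !mxE -[RHS](orth (enum_val i) (enum_val j)).
  transitivity (\sum_(k < #|C|) a (enum_val i) (enum_val k) * b (enum_val j) (enum_val k)).
    by apply: eq_bigr => k _; rewrite !mxE.
  exact/esym/(big_enum_val (fun e => a (enum_val i) e * b (enum_val j) e)).
all: exact: enum_valP.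
Qed.

(** * Finite sums, permutations and the field with two elements *)

(** Determinants use permutations of ordinals, states permutations of crossings;
    this carries the parity from one to the other. *)
Lemma odd_perm_conj (T T' : finType) (f : T -> T') (s : {perm T}) (s' : {perm T'}) :
  bijective f -> (forall x, s' (f x) = f (s x)) -> odd_perm s' = odd_perm s.
Proof.
move=> fbij fs; have finj := bij_inj fbij.
have orb x : porbit s' (f x) = f @: porbit s x.
  have iterE n y : (s' ^+ n)%g (f y) = f ((s ^+ n)%g y).
    by elim: n y => [|n IH] y; rewrite ?expg0 ?perm1 // !expgS !permM fs IH.
  apply/setP => y; apply/porbitP/imsetP => [[n ->] | [z /porbitP[n ->] ->]].
    by exists ((s ^+ n)%g x); rewrite ?mem_porbit ?iterE.
  by exists n; rewrite iterE.
rewrite /odd_perm (bij_eq_card fbij); congr (_ (+) odd _).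
rewrite -(card_imset (porbits s) (imset_inj finj)); apply: eq_card.
move=> A; apply/imsetP/imsetP => [[y _ ->] | [B /imsetP[x _ ->] ->]].
  by case: fbij => g gf fg; exists (porbit s (g y)); rewrite ?imset_f // -orb fg.
by exists (f x); rewrite ?orb.
Qed.

Lemma card_set_sum (T1 T2 : finType) (W : {set T1 + T2}) :
  #|W| = (#|[set a | inl a \in W]| + #|[set b | inr b \in W]|)%N.
Proof.
rewrite -!sum1_card big_sumType /=.
by congr (_ + _)%N; apply: eq_bigl => t; rewrite inE.
Qed.

Lemma card_sum_mem (T : finType) (A : {set T}) : #|A| = (\sum_x (x \in A))%N.
Proof.
rewrite -sum1_card (big_mkcond (op := addn)) /=.
by apply: eq_bigr => x _; case: ifP.
Qed.

Lemma connect_const (T : finType) (U : Type) (r : rel T) (f : T -> U) a b :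
  (forall y z, r y z -> f y = f z) -> connect r a b -> f a = f b.
Proof.
move=> fr /connectP[p]; elim: p a => [|c p IH] a /= => [_ -> // | /andP[/fr -> rp] lp].
exact: IH rp lp.
Qed.

Lemma porbit_fixed (T : finType) (s : {perm T}) t : s t = t -> porbit s t = [set t].
Proof.
move=> st; apply/setP => u; rewrite inE; apply/porbitP/eqP => [[n ->] | ->]; last first.
  by exists 0%N; rewrite perm1.
by elim: n => [|n IH]; rewrite ?perm1 // expgSr permM IH.
Qed.

Lemma sum_hand (U : nmodType) (F : hand -> U) : \sum_h F h = F Left + F Right.
Proof.
rewrite (bigD1 Left) //= (bigD1 Right) //= big1 ?addr0 //.
by case.
Qed.

Lemma sum_corner (U : nmodType) (F : corner -> U) :
  \sum_c F c = F OutCorner + F InCorner + F LeftCorner + F RightCorner.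
Proof.
rewrite (bigD1 OutCorner) //= (bigD1 InCorner) //= (bigD1 LeftCorner) //=.
by rewrite (bigD1 RightCorner) //= big1 ?addr0 ?addrA //; case.
Qed.

Lemma F2_addrr (a : 'F_2) : a + a = 0.
Proof. by apply/eqP; case: a => [[|[|]]]. Qed.

Lemma F2P (a : 'F_2) : a = 0 \/ a = 1.
Proof. by case: a => [[|[|]] // ?]; [left | right]; apply: val_inj. Qed.

Lemma F2_add_eq0 (a b : 'F_2) : (a + b == 0) = (a == b).
Proof. by case: a b => [[|[|]] // ?] [[|[|]]]. Qed.

Lemma sum_delta (T : finType) (F : T -> 'F_2) (a : T) :
  \sum_t F t * (a == t)%:R = F a.
Proof.
rewrite (bigD1 a) //= eqxx mulr1 big1 ?addr0 // => t ta.
by rewrite eq_sym (negPf ta) mulr0.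
Qed.

(** * Edges, corners and regions of a diagram *)

Section Diagram.
Variable D : link_diagram.
Implicit Types (v : crossing D) (e : edge D) (x : crossing D * corner).

(** A corner of the diagram is an edge of the graph that joins crossings to
    regions, and the edges of the diagram are the quadrilateral faces of this
    graph; [edge1] and [edge2] are the faces on the two sides of a corner. *)
Definition edge1 x : edge D := (corner_sides x.1 x.2).1.1.
Definition edge2 x : edge D := (corner_sides x.1 x.2).2.1.
Definition region_at x : {set edge_side D} := corner_region x.1 x.2.

Lemma share_corner_sym : connect_sym (@share_corner D).
Proof.
apply: sym_connect_sym => s t; apply/existsP/existsP => -[v /existsP[c H]];
  by exists v; apply/existsP; exists c; rewrite orbC.
Qed.

Lemma region_of_corner2 v c :
  region_of (corner_sides v c).2 = corner_region v c.
Proof.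
apply/setP => s; rewrite !inE; apply/esym/(same_connect share_corner_sym).
apply/connect1/existsP; exists v; apply/existsP; exists c.
by rewrite -surjective_pairing eqxx.
Qed.

Lemma region_of_in v h h' :
  region_of (in_edge (v, h), h') =
  corner_region v (match h, h' with
    | Left, Left => LeftCorner | Right, Right => RightCorner | _, _ => InCorner
    end).
Proof. by case: h h' => -[] //; rewrite -region_of_corner2. Qed.

Lemma region_of_out v h h' :
  region_of (out_edge (v, h), h') =
  corner_region v (match h, h' with
    | Left, Left => LeftCorner | Right, Right => RightCorner | _, _ => OutCorner
    end).
Proof. by case: h h' => -[] //; rewrite -region_of_corner2. Qed.

Lemma sum_ends (U : nmodType) (ends : crossing D * hand -> edge D)
    (F : edge D -> U) : injective ends ->
  \sum_v (F (ends (v, Left)) + F (ends (v, Right))) =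
  \sum_(e in codom ends) F e.
Proof.
move=> ends_inj; transitivity (\sum_p F (ends p)).
  rewrite [RHS](eq_bigr (fun p => F (ends (p.1, p.2)))) => [|[] //].
  rewrite -(pair_bigA _ (fun v h => F (ends (v, h)))) /=.
  by apply: eq_bigr => v _; rewrite sum_hand.
transitivity (\sum_(e in [set ends p | p in setT]) F e).
  rewrite big_imset /= => [|p q _ _ /ends_inj //].
  by apply: eq_bigl => p; rewrite inE.
apply: eq_bigl => e.
by apply/imsetP/codomP => [[p _ ->] | [p ->]]; exists p.
Qed.

(** An edge that meets a crossing has one head and one tail; the circles without
    crossings contribute to neither sum. *)
Lemma sum_in_out (U : nmodType) (F : edge D -> U) :
  \sum_v (F (in_edge (v, Left)) + F (in_edge (v, Right))) =
  \sum_v (F (out_edge (v, Left)) + F (out_edge (v, Right))).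
Proof.
rewrite (sum_ends _ (@in_edge_inj D)) (sum_ends _ (@out_edge_inj D)).
by apply: eq_bigl => e; apply: in_out_edge.
Qed.

Section Connected.
Hypothesis Dconnected : diagram_connected D.
Variable v0 : crossing D.

(** Connectedness rules out circles without crossings as soon as there is a
    crossing [v0]. *)
Lemma edge_in e : exists p, e = in_edge p.
Proof.
suff: e \in codom (@in_edge D) by case/codomP => p ->; exists p.
have in_incident v : incident v e -> e \in codom (@in_edge D).
  case/existsP => h /orP[/eqP -> | /eqP ->]; first exact: codom_f.
  by rewrite in_out_edge codom_f.
have /connectP[[|f p] /=] := Dconnected e (in_edge (v0, Left)).
  by move=> _ <-; apply: codom_f.
by case/andP => /existsP[v /andP[/in_incident]].
Qed.

Lemma edge_const (U : Type) (phi : edge D -> U) (psi : crossing D -> U) e f :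
  (forall v h, phi (in_edge (v, h)) = psi v) ->
  (forall v h, phi (out_edge (v, h)) = psi v) -> phi e = phi f.
Proof.
move=> phi_in phi_out; apply: (connect_const _ (Dconnected e f)) => a b.
have inc v c : incident v c -> phi c = psi v.
  by case/existsP => h /orP[/eqP -> | /eqP ->].
by case/existsP => v /andP[/inc -> /inc ->].
Qed.

Lemma corner_const_edge (U : Type) (phi : edge D -> U) e f :
  (forall x, phi (edge1 x) = phi (edge2 x)) -> phi e = phi f.
Proof.
move=> phiC; pose psi v := phi (in_edge (v, Left)).
have inR v : phi (in_edge (v, Right)) = psi v.
  exact/esym/(phiC (v, InCorner)).
apply: (edge_const (psi := psi)) => v [] //.
  by rewrite -(phiC (v, LeftCorner)).
by rewrite -(phiC (v, RightCorner)); apply: inR.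
Qed.

Lemma corner_const_vertex (U : Type) (gv : crossing D -> U)
    (gr : {set edge_side D} -> U) :
  (forall x, gv x.1 = gr (region_at x)) ->
  (forall v, gv v = gv v0) /\ (forall r, r \in regions D -> gr r = gv v0).
Proof.
move=> gC; have g_in v h h' : gr (region_of (in_edge (v, h), h')) = gv v.
  by rewrite region_of_in -(gC (v, _)).
have g_out v h h' : gr (region_of (out_edge (v, h), h')) = gv v.
  by rewrite region_of_out -(gC (v, _)).
have g_const v : gv v = gv v0.
  rewrite -(g_in v Left Left) -(g_in v0 Left Left).
  by apply: (edge_const (phi := fun e => gr (region_of (e, Left)))).
split=> // r /imsetP[[e h] _ ->]; have [[v h'] ->] := edge_in e.
by rewrite g_in.
Qed.

Lemma card_edge : #|edge D| = (#|crossing D| * 2)%N.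
Proof.
have <- : #|{: hand}| = 2%N.
  rewrite -card_bool; apply: (bij_eq_card (f := bool_of_hand)).
  by exists hand_of_bool; [apply: bool_of_handK | case].
rewrite -card_prod -(card_codom (@in_edge_inj D)).
by apply: eq_card => e; have [p ->] := edge_in e; rewrite codom_f inE.
Qed.

End Connected.

Lemma card_corner : #|{: crossing D * corner}| = (#|crossing D| * 4)%N.
Proof.
rewrite card_prod; congr (_ * _)%N.
have -> : 4%N = #|{: bool * bool}| by rewrite card_prod card_bool.
apply: (bij_eq_card (f := bools_of_corner)).
by exists corner_of_bools; [apply: bools_of_cornerK | case=> -[] []].
Qed.

(** * Chains modulo 2 on the sphere *)

(** [boundary] sends 2-chains (functions on the faces, that is, on the edges of
    the diagram) to 1-chains (functions on the corners); [coboundary] sends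
    0-cochains, given on crossings and on regions separately, to 1-cochains. *)
Definition boundary (phi : edge D -> 'F_2) x : 'F_2 := phi (edge1 x) + phi (edge2 x).

Definition coboundary (gv : crossing D -> 'F_2) (gr : {set edge_side D} -> 'F_2) x : 'F_2 :=
  gv x.1 + gr (region_at x).

Lemma sum_corners (U : nmodType) (F : crossing D * corner -> U) :
  \sum_x F x = \sum_v (F (v, OutCorner) + F (v, InCorner) +
                      F (v, LeftCorner) + F (v, RightCorner)).
Proof.
rewrite (eq_bigr (fun x => F (x.1, x.2))) => [|[] //].
rewrite -(pair_bigA _ (fun v c => F (v, c))) /=.
by apply: eq_bigr => v _; rewrite sum_corner.
Qed.

(** Each edge of the diagram occurs twice among the corners at each of its ends,
    and each of its sides occurs once at its head and once at its tail, so
    everything cancels modulo 2. *)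
Lemma boundary_coboundary phi gv gr :
  \sum_x boundary phi x * coboundary gv gr x = 0.
Proof.
rewrite sum_corners.
pose H h e := phi e * gr (region_of (e, h)); pose HH e := H Left e + H Right e.
transitivity (\sum_v (HH (in_edge (v, Left)) + HH (in_edge (v, Right))) +
   \sum_v (HH (out_edge (v, Left)) + HH (out_edge (v, Right)))); last first.
  by rewrite sum_in_out F2_addrr.
rewrite -big_split /=; apply: eq_bigr => v _.
rewrite /HH /H !region_of_in !region_of_out.
rewrite /boundary /coboundary /region_at /edge1 /edge2 /=.
set a := phi (in_edge _); set b := phi (in_edge _).
set c := phi (out_edge _); set d := phi (out_edge _).
set o := gr _; set i := gr _; set l := gr _; set r := gr _.
transitivity (a * l + a * i + (b * i + b * r) + (c * l + c * o + (d * o + d * r)) +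
   (a + a + (b + b) + (c + c) + (d + d)) * gv v).
  ring.
by rewrite !F2_addrr mul0r addr0.
Qed.

(** The second summand also contains sets that are not regions; the families of
    vertices below are restricted to [regions D]. *)
Definition vertex : finType := (crossing D + {set edge_side D})%type.

Definition face_corners e x : 'F_2 := (edge1 x == e)%:R + (edge2 x == e)%:R.

Definition vertex_corners (w : vertex) x : 'F_2 :=
  match w with inl v => (x.1 == v)%:R | inr r => (region_at x == r)%:R end.

Lemma sum_face_corners phi x :
  \sum_e phi e * face_corners e x = boundary phi x.
Proof.
under eq_bigr do rewrite mulrDr.
by rewrite big_split /= !sum_delta.
Qed.

Lemma sum_vertex_corners (g : vertex -> 'F_2) x :
  \sum_w g w * vertex_corners w x = coboundary (g \o inl) (g \o inr) x.
Proof. by rewrite big_sumType /= !sum_delta. Qed.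

Lemma sum_chain_vertex (z : crossing D * corner -> 'F_2) (w : vertex) :
  (forall gv gr, \sum_x z x * coboundary gv gr x = 0) ->
  \sum_x z x * vertex_corners w x = 0.
Proof.
case: w => [v | r] z0.
  rewrite -[RHS](z0 (fun u => (u == v)%:R) (fun=> 0)).
  by apply: eq_bigr => x _; rewrite /coboundary addr0.
rewrite -[RHS](z0 (fun=> 0) (fun s => (s == r)%:R)).
by apply: eq_bigr => x _; rewrite /coboundary add0r.
Qed.

Section Sphere.
Hypotheses (Dconnected : diagram_connected D) (Dplanar : diagram_planar D).
Variable v0 : crossing D.

Lemma boundary0_const phi e f : (forall x, boundary phi x = 0) -> phi e = phi f.
Proof.
move=> phi0; apply: (corner_const_edge Dconnected) => x.
by apply/eqP; rewrite -F2_add_eq0; apply/eqP/phi0.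
Qed.

Lemma coboundary0_const gv gr : (forall x, coboundary gv gr x = 0) ->
  (forall v, gv v = gv v0) /\ (forall r, r \in regions D -> gr r = gv v0).
Proof.
move=> g0; apply: (corner_const_vertex Dconnected) => x.
by apply/eqP; rewrite -F2_add_eq0; apply/eqP/g0.
Qed.

(** The first homology of the sphere vanishes.  If [z] were not a boundary, then
    it could replace one face in the family of faces and leave it independent;
    these 2n vectors are orthogonal to the 2n + 1 coboundaries of all vertices
    but one, although there are only 4n corners. *)
Lemma cycle_boundary (z : crossing D * corner -> 'F_2) :
  (forall gv gr, \sum_x z x * coboundary gv gr x = 0) ->
  exists phi, forall x, z x = boundary phi x.
Proof.
move=> zcyc.
case: (boolP [exists phi : {ffun edge D -> 'F_2}, [forall x, z x == boundary phi x]]).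
  by case/existsP => phi /forallP zphi; exists phi => x; apply/eqP.
move=> /existsPn z_nobd; exfalso.
pose e0 := in_edge (v0, Left).
(* The face [e0] gives way to the chain [z]. *)
pose a e x := if e == e0 then z x else face_corners e x.
pose B : {set vertex} := [set w | match w with inl v => v != v0 | inr r => r \in regions D end].
have : (#|[set: edge D]| + #|B| <= #|[set: crossing D * corner]|)%N.
  apply: (@orthogonal_families _ _ _ _ _ B _ a vertex_corners).
  - move=> e w _ _; rewrite (eq_bigl _ _ (in_setT (T := _))) sum_chain_vertex //.
    rewrite /a; case: eqP => // _ gv gr.
    exact: (boundary_coboundary (fun f => (f == e)%:R)).
  - move=> phi _ phi0 f; pose psi e := if e == e0 then 0 else phi e.
    have eq0 x : phi e0 * z x + boundary psi x = 0.
      rewrite -[RHS](phi0 x) ?inE // -sum_face_corners !(bigD1 e0 (P := xpredT)) //=.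
      rewrite /a /psi eqxx mul0r add0r; congr (_ + _).
      by apply: eq_bigr => e /negPf ->.
    have pN0 : phi e0 = 0.
      have [//|p1] := F2P (phi e0).
      have /forallPn[x] := z_nobd [ffun e => psi e].
      rewrite /boundary !ffunE -F2_add_eq0.
      by rewrite -[z x]mul1r -p1 eq0 eqxx.
    have [-> // | ff0] := eqVneq f e0.
    rewrite -(_ : psi f = phi f); last by rewrite /psi (negPf ff0).
    rewrite (@boundary0_const psi f e0) => [|x]; first by rewrite /psi eqxx.
    by rewrite -[RHS](eq0 x) pN0 mul0r add0r.
  - move=> g gB g0 w.
    have [x|gv gr] := @coboundary0_const (g \o inl) (g \o inr).
      by rewrite -sum_vertex_corners g0 ?inE.
    have gv0 : g (inl v0) = 0 by apply: gB; rewrite inE eqxx.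
    case: w => [v | r]; first exact: etrans (gv v) gv0.
    case: (boolP (r \in regions D)) => rD; first exact: etrans (gr r rD) gv0.
    by apply: gB; rewrite inE.
have cB : (#|B|.+1 = #|crossing D| + #|regions D|)%N.
  have := cardsC1 v0; rewrite card_set_sum.
  have -> : [set v | inl v \in B] = [set~ v0] by apply/setP => u; rewrite !inE.
  have -> : [set r | inr r \in B] = regions D by apply/setP => u; rewrite !inE.
  have : (0 < #|crossing D|)%N by apply/card_gt0P; exists v0.
  by move=> n0 ->; rewrite -addSn prednK.
rewrite !cardsT card_corner (card_edge Dconnected v0); move: cB; rewrite Dplanar.
lia.
Qed.

Definition filled phi : {set edge D} := [set e | phi e == 1 :> 'F_2].
Definition interior_corners phi : {set crossing D * corner} :=
  [set x | (edge1 x \in filled phi) && (edge2 x \in filled phi)].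

Lemma filledPn phi e : e \notin filled phi -> phi e = 0.
Proof. by rewrite inE; case: (F2P (phi e)) => ->. Qed.

Lemma vertex_corners_neq0 w x : vertex_corners w x != 0 ->
  w = inl x.1 \/ w = inr (region_at x).
Proof.
case: w => [v | r] /=; first by case: (x.1 =P v) => [<- | //]; left.
by case: (region_at x =P r) => [<- | //]; right.
Qed.

(** Half of Euler's formula for the side of a cycle where [phi] is 1.  The faces
    of that side but one are independent on the interior corners: a combination
    that vanishes there has its boundary on the cycle, so by minimality of the
    cycle it is trivial or the whole side.  The coboundaries of the vertices [B]
    enclosed by the cycle live on interior corners, and they are independent
    because the graph is connected and the cycle contains a vertex outside
    [B]. *)
Lemma disk_bound phi (B : {set vertex}) x0 :
  boundary phi x0 = 1 ->
  (forall psi, (forall x, boundary phi x = 0 -> boundary psi x = 0) ->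
     (forall x, boundary psi x = 0) \/ (forall x, boundary psi x = boundary phi x)) ->
  (forall x, inl x.1 \in B \/ inr (region_at x) \in B -> x \in interior_corners phi) ->
  inl x0.1 \notin B -> (forall r, inr r \in B -> r \in regions D) ->
  (#|filled phi| + #|B| <= #|interior_corners phi|.+1)%N.
Proof.
move=> bd0 simple inB x0B Breg.
have [f0 [f1 [phif0 phif1]]] : exists f0 f1, phi f0 = 1 /\ phi f1 = 0.
  move: bd0; rewrite /boundary.
  case: (F2P (phi (edge1 x0))) (F2P (phi (edge2 x0))) => E1 [] E2; rewrite E1 E2 ?addr0.
  - by move/eqP.
  - by exists (edge2 x0), (edge1 x0).
  - by exists (edge1 x0), (edge2 x0).
  - by move/eqP.
rewrite (cardsD1 f0) inE phif0 eqxx add1n addSn ltnS.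
have inC w x : w \in B -> vertex_corners w x != 0 -> x \in interior_corners phi.
  by move=> wB /vertex_corners_neq0[] Ew; apply: inB; [left | right]; rewrite -Ew.
apply: (@orthogonal_families _ _ _ _ _ _ _ face_corners vertex_corners).
- move=> f w _ wB; transitivity (\sum_x face_corners f x * vertex_corners w x).
    rewrite [RHS](bigID (mem (interior_corners phi))) /= [X in _ = _ + X]big1 ?addr0 // => x xC.
    by apply/eqP; rewrite mulf_eq0 orbC; apply/orP; left; apply: contraNT xC; apply: inC.
  apply: sum_chain_vertex => gv gr.
  exact: (boundary_coboundary (fun e => (e == f)%:R)).
- move=> psi psi0 psiC f.
  have psif0 : psi f0 = 0 by apply: psi0; rewrite !inE eqxx.
  have off e : phi e = 0 -> psi e = 0.
    by move=> e0; apply: psi0; rewrite !inE e0 andbF.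
  have [x bd_x | bdpsi | bdpsi] := simple psi.
  + have phi12 : phi (edge1 x) = phi (edge2 x) by apply/eqP; rewrite -F2_add_eq0; apply/eqP.
    have [xC | ] := boolP (x \in interior_corners phi).
      by rewrite -sum_face_corners psiC.
    rewrite inE !inE phi12 andbb /boundary.
    have [E2 _ | -> //] := F2P (phi (edge2 x)).
    by rewrite !off // ?addr0 // phi12.
  + by rewrite (boundary0_const f f0 bdpsi).
  have sum0 x : boundary (fun e => psi e + phi e) x = 0.
    by rewrite /boundary addrACA -![_ + _ (edge2 x)]/(boundary _ x) bdpsi F2_addrr.
  have := boundary0_const f1 f0 sum0.
  by rewrite psif0 phif0 phif1 off // addr0 => /eqP.
- move=> g gB gC.
  have g0 x : coboundary (g \o inl) (g \o inr) x = 0.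
    have [xC | xC] := boolP (x \in interior_corners phi).
      by rewrite -sum_vertex_corners gC.
    by rewrite /coboundary /= !gB ?addr0 //; apply: contra xC => ?; apply: inB; [right | left].
  have [gv gr] := coboundary0_const g0.
  have gv0 : g (inl v0) = 0 by rewrite -[LHS](gv x0.1) /= gB.
  case=> [v | r]; first exact: etrans (gv v) gv0.
  have [/Breg rD | ] := boolP (inr r \in B); first exact: etrans (gr r rD) gv0.
  exact: gB.
Qed.

Lemma sum_in (U : nmodType) (F : edge D -> U) :
  \sum_v (F (in_edge (v, Left)) + F (in_edge (v, Right))) = \sum_e F e.
Proof.
rewrite (sum_ends _ (@in_edge_inj D)); apply: eq_bigl => e.
by have [p ->] := edge_in Dconnected v0 e; rewrite codom_f.
Qed.

(** Every filled face has four corners; interior corners are counted twice and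
    those on the boundary once. *)
Lemma card_interior_corners phi :
  (#|interior_corners phi| * 2 + #|[set x | boundary phi x == 1%R]| = #|filled phi| * 4)%N.
Proof.
pose f e : nat := e \in filled phi.
transitivity (\sum_x (f (edge1 x) + f (edge2 x)))%N.
  rewrite 2!card_sum_mem (big_distrl (plus := addn)) /= -(big_split addn) /=.
  apply: eq_bigr => x _; rewrite /f !inE /boundary.
  by case: (F2P (phi (edge1 x))) (F2P (phi (edge2 x))) => -> [] ->.
have sf : (\sum_v (f (in_edge (v, Left)) + f (in_edge (v, Right))) = #|filled phi|)%N.
  rewrite [LHS](sum_in (U := nat)) -sum1_card [RHS]big_mkcond /=.
  by apply: eq_bigr => e _; rewrite /f; case: ifP.
have sf' : (\sum_v (f (out_edge (v, Left)) + f (out_edge (v, Right))) = #|filled phi|)%N.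
  by rewrite -sf; apply/esym/(sum_in_out (U := nat)).
rewrite [LHS](sum_corners (U := nat)).
have -> : (#|filled phi| * 4 = (\sum_v (f (in_edge (v, Left)) + f (in_edge (v, Right)))) * 2 +
  (\sum_v (f (out_edge (v, Left)) + f (out_edge (v, Right)))) * 2)%N by rewrite sf sf'; lia.
rewrite !big_distrl -big_split /=; apply: eq_bigr => v _.
rewrite /edge1 /edge2 /=.
move: (f _) (f _) (f _) (f _) => a b c d.
change ((d + c + (b + a) + (b + d) + (a + c))%N = ((b + a) * 2 + (d + c) * 2)%N); lia.
Qed.

(** * The sign of a state *)

Variables R1 R2 : {set edge_side D}.
Hypothesis starred : regions_adjacent R1 R2.
Implicit Types S : {ffun crossing D -> corner}.

Lemma marker_inj S : S \in states R1 R2 -> injective (marker_region S).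
Proof. by rewrite inE => /andP[_ /injectiveP]. Qed.

Lemma marker_unstarred S v : S \in states R1 R2 ->
  [/\ marker_region S v \in regions D, marker_region S v != R1 & marker_region S v != R2].
Proof.
by rewrite inE => /andP[/forallP/(_ v)/andP[H1 H2] _]; split=> //; apply: imset_f.
Qed.

(** There are n + 2 regions, so the n markers occupy every unstarred region. *)
Lemma marker_onto S r : S \in states R1 R2 -> r \in regions D -> r != R1 -> r != R2 ->
  exists v, r = marker_region S v.
Proof.
move=> SS rD r1 r2; case: starred => R1D R2D R12 _.
have sub : [set marker_region S v | v in setT] \subset regions D :\: [set R1; R2].
  apply/subsetP => _ /imsetP[v _ ->]; have [H H1 H2] := marker_unstarred v SS.
  by rewrite !inE negb_or H H1 H2.
have /eqP : [set marker_region S v | v in setT] == regions D :\: [set R1; R2].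
  rewrite eqEcard sub card_imset ?cardsT; last exact: marker_inj.
  rewrite cardsD (_ : _ :&: _ = [set R1; R2]); last first.
    by apply/setIidPr/subsetP => s /set2P[] ->.
  by rewrite cards2 R12 Dplanar addnK leqnn.
move/setP/(_ r); rewrite !inE negb_or r1 r2 rD => /imsetP[v _ ->].
by exists v.
Qed.

Section Orbit.
Variables (S1 S2 : {ffun crossing D -> corner}) (s : {perm crossing D}) (v1 : crossing D).
Hypotheses (S1S : S1 \in states R1 R2) (S2S : S2 \in states R1 R2).
Hypothesis S12 : forall v, marker_region S2 v = marker_region S1 (s v).
Let O := porbit s v1.
Hypothesis S1neqS2 : forall v, v \in O -> S1 v != S2 v.

Let perm_orbit v : (s v \in O) = (v \in O).
Proof.
rewrite -!eq_porbit_mem; congr (_ == _).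
by have := porbit_perm s 1 v; rewrite expg1.
Qed.

(** The cycle of the two states along one orbit: from each crossing to the region
    that it marks in either state. *)
Definition orbit_cycle x : 'F_2 :=
  (x.1 \in O)%:R * ((x.2 == S1 x.1)%:R + (x.2 == S2 x.1)%:R).

Lemma sum_orbit_support (y F : crossing D * corner -> 'F_2) :
  (forall x, orbit_cycle x = 0 -> y x = 0) ->
  \sum_x y x * F x = \sum_(v in O) (y (v, S1 v) * F (v, S1 v) + y (v, S2 v) * F (v, S2 v)).
Proof.
move=> y0; rewrite (eq_bigr (fun x => y (x.1, x.2) * F (x.1, x.2))) => [|[] //].
rewrite -(pair_bigA _ (fun v c => y (v, c) * F (v, c))) /= [RHS]big_mkcond /=.
apply: eq_bigr => v _; case: ifP => vO; last first.
  by apply: big1 => c _; rewrite y0 ?mul0r // /orbit_cycle /= vO mul0r.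
rewrite (bigD1 (S1 v)) //= (bigD1 (S2 v)) /=; last by rewrite eq_sym S1neqS2.
rewrite big1 ?addr0 // => c /andP[/negPf c1 /negPf c2].
by rewrite y0 ?mul0r // /orbit_cycle /= c1 c2 addr0 mulr0.
Qed.

Lemma orbit_cycle1 v : v \in O -> orbit_cycle (v, S1 v) = 1.
Proof.
by move=> vO; rewrite /orbit_cycle /= vO eqxx (negPf (S1neqS2 vO)) addr0 mulr1.
Qed.

Lemma orbit_cycle2 v : v \in O -> orbit_cycle (v, S2 v) = 1.
Proof.
by move=> vO; rewrite /orbit_cycle /= vO eqxx eq_sym (negPf (S1neqS2 vO)) add0r mulr1.
Qed.

Lemma orbit_cycle_closed gv gr : \sum_x orbit_cycle x * coboundary gv gr x = 0.
Proof.
rewrite sum_orbit_support //.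
transitivity (\sum_(v in O) gr (marker_region S1 v) + \sum_(v in O) gr (marker_region S2 v)).
  rewrite -big_split; apply: eq_bigr => v vO /=.
  by rewrite orbit_cycle1 // orbit_cycle2 // !mul1r /coboundary /= addrACA F2_addrr add0r.
rewrite (reindex_inj (@perm_inj _ s)) /= (eq_bigl (mem O)); last exact: perm_orbit.
by under [X in _ + X]eq_bigr do rewrite S12; rewrite F2_addrr.
Qed.

(** A boundary is orthogonal to the coboundary of each vertex, and the cycle has
    exactly two corners at each of its vertices.  A boundary carried by the cycle
    therefore takes the same value on consecutive corners of the cycle. *)
Lemma orbit_cycle_minimal psi :
  (forall x, orbit_cycle x = 0 -> boundary psi x = 0) ->
  (forall x, boundary psi x = 0) \/ (forall x, boundary psi x = orbit_cycle x).
Proof.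
set y := boundary psi => y0.
have atv v : v \in O -> y (v, S1 v) = y (v, S2 v).
  move=> vO; apply/eqP; rewrite -F2_add_eq0.
  have := boundary_coboundary psi (fun u => (u == v)%:R) (fun=> 0).
  rewrite -/y sum_orbit_support // (bigD1 v) //= big1 => [|u /andP[_ /negPf uv]].
    by rewrite /coboundary /= eqxx !addr0 !mulr1 => ->.
  by rewrite /coboundary /= uv !addr0 !mulr0 addr0.
have ats v : v \in O -> y (s v, S1 (s v)) = y (v, S1 v).
  move=> vO; rewrite [RHS]atv //; apply/eqP; rewrite -F2_add_eq0.
  have := boundary_coboundary psi (fun=> 0) (fun r => (r == marker_region S2 v)%:R).
  rewrite -/y sum_orbit_support // big_split /=.
  rewrite (bigD1 (s v)) ?perm_orbit //= big1 => [|u /andP[_ /negPf uv]]; last first.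
    by rewrite /coboundary /= S12 (inj_eq (marker_inj S1S)) uv !add0r mulr0.
  rewrite (bigD1 v) //= big1 => [|u /andP[_ /negPf uv]]; last first.
    by rewrite /coboundary /= (inj_eq (marker_inj S2S)) uv !add0r mulr0.
  rewrite /coboundary /=.
  have -> : region_at (s v, S1 (s v)) = marker_region S2 v by rewrite S12.
  by rewrite -[region_at _]/(marker_region S2 v) eqxx !addr0 !add0r !mulr1 => ->.
have y_const v : v \in O -> y (v, S1 v) = y (v1, S1 v1).
  case/porbitP => n ->; elim: n => [|n IH]; first by rewrite perm1.
  by rewrite expgSr permM ats ?mem_porbit.
have y_on x : orbit_cycle x != 0 -> y x = y (v1, S1 v1).
  case: x => v c; rewrite /orbit_cycle /=; case: (boolP (v \in O)) => vO; last first.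
    by rewrite mul0r eqxx.
  rewrite mul1r; case: (c =P S1 v) => [-> _ | _]; first exact: y_const.
  by case: (c =P S2 v) => [-> _ | _]; rewrite ?addr0 ?eqxx // -atv ?y_const.
case: (F2P (y (v1, S1 v1))) => yv1; [left | right] => x;
  case: (F2P (orbit_cycle x)) => zx.
- exact: y0.
- by rewrite y_on ?zx.
- by rewrite zx y0.
- by rewrite y_on ?zx.
Qed.

Lemma card_orbit_cycle : #|[set x | orbit_cycle x == 1]| = (#|O| * 2)%N.
Proof.
have -> : [set x | orbit_cycle x == 1] =
    [set (v, S1 v) | v in O] :|: [set (v, S2 v) | v in O].
  apply/setP => -[v c]; rewrite !inE; apply/idP/orP.
    rewrite /orbit_cycle /=; case: (boolP (v \in O)) => vO; last by rewrite mul0r.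
    case: (c =P S1 v) => [-> _ | _]; first by left; apply/imsetP; exists v.
    case: (c =P S2 v) => [-> _ | _]; first by right; apply/imsetP; exists v.
    by rewrite addr0 mulr0.
  by case=> /imsetP[u uO [-> ->]]; rewrite ?orbit_cycle1 ?orbit_cycle2.
rewrite cardsU (_ : _ :&: _ = set0) ?cards0 ?subn0; last first.
  apply/setP => x; rewrite !inE; apply/negP => /andP[/imsetP[v vO ->] /imsetP[u _ []]].
  by move=> <- /eqP; rewrite (negPf (S1neqS2 vO)).
by rewrite !card_imset ?muln2 ?addnn // => u v [].
Qed.

(** An edge on the boundary of [r]: away from the cycle a 2-chain with boundary
    [orbit_cycle] is constant around [r], so one edge tells on which side of the
    cycle [r] lies. *)
Definition side_edge (r : {set edge_side D}) : edge D :=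
  if [pick t in r] is Some t then t.1 else in_edge (v0, Left).

Lemma side_edgeP r : r \in regions D -> exists h, (side_edge r, h) \in r.
Proof.
rewrite /side_edge; case: pickP => [[e h] rt _ | r0 /imsetP[t _ Er]]; first by exists h.
by have := r0 t; rewrite Er inE connect0.
Qed.

Lemma boundary0_region phi t u :
  (forall x, region_at x = region_of t -> boundary phi x = 0) ->
  u \in region_of t -> phi t.1 = phi u.1.
Proof.
move=> phi0; rewrite inE => tu.
pose f a := if region_of a == region_of t then phi a.1 else 0.
have fstep v c : f (corner_sides v c).1 = f (corner_sides v c).2.
  rewrite /f region_of_corner2; case: eqP => // rt.
  by apply/eqP; rewrite -F2_add_eq0; apply/eqP; apply: (phi0 (v, c)).
have : f t = f u.
  apply: connect_const tu => a b /existsP[v /existsP[c]].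
  by case/orP => /eqP Evc; have := fstep v c; rewrite Evc.
rewrite /f eqxx; suff -> : region_of u = region_of t by rewrite eqxx.
by apply/setP => a; rewrite !inE; apply/esym/(same_connect share_corner_sym).
Qed.

Definition inside_crossings phi : {set crossing D} :=
  [set v in ~: O | phi (in_edge (v, Left)) == 1 :> 'F_2].
Definition inside_regions phi : {set {set edge_side D}} :=
  [set r in regions D :\: [set marker_region S1 v | v in O] | phi (side_edge r) == 1 :> 'F_2].

Definition inside phi : {set vertex} :=
  [set w | match w with
           | inl v => v \in inside_crossings phi
           | inr r => r \in inside_regions phi
           end].

Lemma card_inside phi : #|inside phi| = (#|inside_crossings phi| + #|inside_regions phi|)%N.
Proof.
by rewrite card_set_sum; congr (_ + _)%N; apply: eq_card => w; rewrite !inE.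
Qed.

Section Inside.
Variable phi : edge D -> 'F_2.
Hypothesis phiP : forall x, boundary phi x = orbit_cycle x.

Lemma inside_crossing_edges v h : v \notin O ->
  phi (in_edge (v, h)) = phi (in_edge (v, Left)) /\
  phi (out_edge (v, h)) = phi (in_edge (v, Left)).
Proof.
move=> vO; have eqc c : phi (edge1 (v, c)) = phi (edge2 (v, c)).
  apply/eqP; rewrite -F2_add_eq0 -[_ + _]/(boundary phi (v, c)) phiP.
  by rewrite /orbit_cycle /= (negPf vO) mul0r.
have iR := eqc InCorner; have oL := eqc LeftCorner; have oR := eqc RightCorner.
move: iR oL oR; rewrite /edge1 /edge2 /= => iR oL oR.
by case: h; rewrite -?oL -?oR -?iR.
Qed.

Lemma inside_region_sides r t : r \in regions D ->
  r \notin [set marker_region S1 v | v in O] -> t \in r -> phi t.1 = phi (side_edge r).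
Proof.
move=> rD rO tr; have [h hr] := side_edgeP rD.
have [a _ ra] := imsetP rD; move: tr hr rO; rewrite ra => ta ha rO.
rewrite -[side_edge _]/(side_edge (region_of a), h).1.
have phi0 x : region_at x = region_of a -> boundary phi x = 0.
  case: x => v c xa; rewrite phiP /orbit_cycle /=.
  case: (boolP (v \in O)) => vO; rewrite ?mul0r // mul1r.
  move: rO; rewrite -xa; case: (c =P S1 v) => [-> | _].
    by rewrite -[region_at _]/(marker_region S1 v) imset_f.
  case: (c =P S2 v) => [-> | _ _]; last by rewrite addr0.
  by rewrite -[region_at _]/(marker_region S2 v) S12 imset_f ?perm_orbit.
by rewrite -(boundary0_region phi0 ta) -(boundary0_region phi0 ha).
Qed.

Lemma inside_disk_bound :
  (#|filled phi| + #|inside phi| <= #|interior_corners phi|.+1)%N.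
Proof.
apply: (@disk_bound phi _ (v1, S1 v1)).
- by rewrite phiP orbit_cycle1 // porbit_id.
- move=> psi psi0; have [x zx | bd | bd] := @orbit_cycle_minimal psi.
  + by apply: psi0; rewrite phiP.
  + by left.
  by right => x; rewrite phiP.
- move=> [v c] /=; rewrite !inE /= => -[/andP[vO /eqP phi1] | /andP[/andP[rO rD] /eqP phi1]].
    have [[iL oL] [iR oR]] := (inside_crossing_edges Left vO, inside_crossing_edges Right vO).
    by case: c; rewrite /edge1 /edge2 /= ?iL ?iR ?oL ?oR phi1.
  have side t : t \in region_at (v, c) -> phi t.1 = 1.
    by move=> tr; rewrite (inside_region_sides rD rO tr).
  rewrite !side ?eqxx //; first by rewrite /region_at -region_of_corner2 inE connect0.
  by rewrite /region_at /corner_region inE connect0.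
- by rewrite !inE /= porbit_id.
- by move=> r; rewrite !inE => /andP[/andP[_ ->]].
Qed.

(** With F filled faces and k crossings on the cycle there are 2F - k interior
    corners, and [disk_bound] becomes V + k <= F + 1 for V enclosed vertices. *)
Lemma inside_bound : (#|inside phi| + #|O| <= #|filled phi|.+1)%N.
Proof.
have := card_interior_corners phi; have := inside_disk_bound.
rewrite (_ : [set x | _] = [set x | orbit_cycle x == 1]); last first.
  by apply/setP => x; rewrite !inE phiP.
by rewrite card_orbit_cycle; lia.
Qed.

(** If the starred regions lie outside the cycle, then the state [S1] matches the
    enclosed crossings with the enclosed regions. *)
Lemma inside_crossings_regions e h :
  phi e = 0 -> (e, h) \in R1 -> (e, opp_hand h) \in R2 ->
  #|inside_crossings phi| = #|inside_regions phi|.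
Proof.
move=> phie eR1 eR2; case: starred => R1D R2D _ _.
rewrite -(card_imset _ (marker_inj S1S)); apply: eq_card => r.
have side v : v \notin O -> phi (side_edge (marker_region S1 v)) = phi (in_edge (v, Left)).
  move=> vO; have [rD _ _] := marker_unstarred v S1S.
  have rO : marker_region S1 v \notin [set marker_region S1 u | u in O].
    by rewrite (mem_imset _ _ (marker_inj S1S)).
  rewrite -(@inside_region_sides _ (corner_sides v (S1 v)).1) //; last first.
    by rewrite /marker_region /corner_region inE connect0.
  have [[iL oL] [iR oR]] := (inside_crossing_edges Left vO, inside_crossing_edges Right vO).
  by case: (S1 v).
apply/imsetP/idP => [[v] | ].
  rewrite !inE => /andP[vO phi1] ->; have [-> _ _] := marker_unstarred v S1S.
  by rewrite (mem_imset _ _ (marker_inj S1S)) vO side.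
rewrite !inE => /andP[/andP[rO rD] phi1].
have notR t (R : {set edge_side D}) : t \in R -> phi t.1 = 0 -> r != R.
  move=> tR phit; apply: contraTneq phi1 => rR.
  by rewrite -(inside_region_sides rD rO (t := t)) ?rR // phit.
have [v Er] := marker_onto S1S rD (notR (e, h) R1 eR1 phie) (notR _ R2 eR2 phie).
have vO : v \notin O by move: rO; rewrite Er (mem_imset _ _ (marker_inj S1S)).
by exists v; rewrite // !inE vO -side // -Er.
Qed.

End Inside.

(** The two sides of the cycle are given by [phi] and [phi + 1].  Over the whole
    sphere the two inequalities [inside_bound] add up to an equality, so both are
    equalities.  As the number of enclosed vertices is even, #|filled phi| + 1
    and #|O| have the same parity.  Finally every edge has exactly one head, so
    that summing [boundary phi] over the ingoing corners counts the filled
    faces; there [boundary phi] marks the black holes of the two states. *)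
Lemma orbit_black_holes :
  \sum_(v in O) ((S1 v == InCorner)%:R + (S2 v == InCorner)%:R) = (#|O|.+1)%:R :> 'F_2.
Proof.
have [_ _ _ [e [h [eR1 eR2]]]] := starred.
have [phi0 phi0P] := cycle_boundary orbit_cycle_closed.
(* Normalised so that the edge between the two starred regions is not filled. *)
pose phi f := phi0 f + phi0 e; pose phi' f := phi f + 1.
have phiP x : boundary phi x = orbit_cycle x.
  by rewrite /boundary /phi addrACA F2_addrr addr0 phi0P.
have phi'P x : boundary phi' x = orbit_cycle x.
  by rewrite /boundary /phi' addrACA F2_addrr addr0 -phiP.
have phie : phi e = 0 by apply: F2_addrr.
have eq1 f : (phi' f == 1) = (phi f != 1).
  by rewrite /phi'; case: (F2P (phi f)) => ->.
have cF : (#|filled phi| + #|filled phi'| = #|crossing D| * 2)%N.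
  rewrite -(card_edge Dconnected v0) -(cardsC (filled phi)); congr (_ + _)%N.
  by apply: eq_card => f; rewrite !inE eq1.
have cX : (#|inside_crossings phi| + #|inside_crossings phi'| + #|O| = #|crossing D|)%N.
  rewrite -(cardsC O) addnC; congr (_ + _)%N.
  rewrite -[RHS](cardsID [set v | phi (in_edge (v, Left)) == 1]); congr (_ + _)%N;
    by apply: eq_card => v; rewrite !inE ?eq1 // andbC.
have cY : (#|inside_regions phi| + #|inside_regions phi'| + #|O| = #|crossing D| + 2)%N.
  rewrite -Dplanar -(card_imset _ (marker_inj S1S)).
  rewrite -[RHS](cardsID [set marker_region S1 v | v in O]) addnC; congr (_ + _)%N.
    rewrite (setIidPr _) //; apply/subsetP => _ /imsetP[v _ ->].
    by have [] := marker_unstarred v S1S.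
  rewrite -[RHS](cardsID [set r | phi (side_edge r) == 1]); congr (_ + _)%N;
    by apply: eq_card => v; rewrite !inE ?eq1 // andbC.
have b := inside_bound phiP; have b' := inside_bound phi'P.
have XY := inside_crossings_regions phiP phie eR1 eR2.
rewrite !card_inside in b b'.
have cO : (#|inside_crossings phi| * 2 + #|O| = #|filled phi|.+1)%N by lia.
transitivity (\sum_f phi f).
  rewrite -sum_in [LHS]big_mkcond /=; apply: eq_bigr => v _.
  rewrite -[RHS]/(boundary phi (v, InCorner)) phiP /orbit_cycle /=.
  by case: ifP; rewrite ?mul0r // mul1r ![InCorner == _]eq_sym.
transitivity (#|filled phi|%:R : 'F_2).
  rewrite card_sum_mem natr_sum; apply: eq_bigr => f _; rewrite inE.
  by case: (F2P (phi f)) => ->.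
have odd2 k : (k + k)%:R = 0 :> 'F_2 by rewrite natrD F2_addrr.
apply/eqP; rewrite -F2_add_eq0 -natrD; apply/eqP.
rewrite -[RHS](odd2 (#|inside_crossings phi| + #|O|)%N); congr _%:R; lia.
Qed.

End Orbit.
End Sphere.

Section StateSum.
Hypotheses (Dconnected : diagram_connected D) (Dplanar : diagram_planar D).
Variables R1 R2 : {set edge_side D}.
Hypothesis starred : regions_adjacent R1 R2.
Implicit Types S : {ffun crossing D -> corner}.

(** Kauffman's sign theorem.  The parity of a permutation is the sum of #|O| + 1
    over its orbits O, and so is the number of black holes by
    [orbit_black_holes]; where both states use the same corner the orbit is a
    single crossing, and both contributions are even. *)
Lemma black_holes_perm S1 S2 (s : {perm crossing D}) :
  S1 \in states R1 R2 -> S2 \in states R1 R2 ->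
  (forall v, marker_region S2 v = marker_region S1 (s v)) ->
  odd_perm s = odd (#|black_holes S1| + #|black_holes S2|).
Proof.
move=> S1S S2S S12.
pose F v : 'F_2 := (S1 v == InCorner)%:R + (S2 v == InCorner)%:R.
have orbitF v1 : \sum_(v in porbit s v1) F v = (#|porbit s v1|.+1)%:R.
  have [/forall_inP neq | ] := boolP [forall v in porbit s v1, S1 v != S2 v].
    exact: (orbit_black_holes Dconnected Dplanar v1 starred S1S S2S S12).
  rewrite negb_forall_in => /exists_inP[v vO /negPn/eqP Sv].
  have sv : s v = v.
    by apply/esym/(marker_inj S1S); rewrite -S12 /marker_region Sv.
  have -> : porbit s v1 = [set v].
    by rewrite -(porbit_fixed sv); apply/eqP; rewrite eq_sym eq_porbit_mem.
  by rewrite big_set1 cards1 /F Sv F2_addrr -natr1 F2_addrr.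
have sumF : \sum_v F v = (#|crossing D| + #|porbits s|)%:R.
  have part G : \sum_v G v = \sum_(A in porbits s) \sum_(v in A) G v :> 'F_2.
    rewrite (partition_big (porbit s) (mem (porbits s))) => [|v _]; last exact: imset_f.
    apply: eq_bigr => _ /imsetP[v1 _ ->]; apply: eq_bigl => v.
    by rewrite eq_porbit_mem.
  have cardE : #|crossing D|%:R = \sum_(v : crossing D) 1 :> 'F_2.
    by rewrite -sum1_card natr_sum.
  rewrite natrD cardE.
  rewrite -sum1_card natr_sum !part -big_split /=.
  apply: eq_bigr => _ /imsetP[v1 _ ->].
  by rewrite orbitF sumr_const -natr1.
have -> : odd_perm s = odd (#|crossing D| + #|porbits s|) by rewrite oddD.
have F2odd a b : a%:R = b%:R :> 'F_2 -> odd a = odd b.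
  move=> ab; have : (odd a)%:R = (odd b)%:R :> 'F_2.
    have red k : (odd k)%:R = k%:R :> 'F_2.
      by rewrite -[k in RHS]odd_double_half natrD -addnn natrD F2_addrr addr0.
    by rewrite !red.
  by case: (odd a); case: (odd b).
apply: F2odd; rewrite -sumF natrD !card_sum_mem !natr_sum -big_split /=.
by apply: eq_bigr => v _; rewrite !inE.
Qed.

Lemma state_perm S0 S : S0 \in states R1 R2 -> S \in states R1 R2 ->
  exists s : {perm crossing D}, forall v, marker_region S v = marker_region S0 (s v).
Proof.
move=> S0S SS.
pose f v := odflt v [pick w | marker_region S v == marker_region S0 w].
have fP v : marker_region S v = marker_region S0 (f v).
  rewrite /f; case: pickP => [w /eqP //|none].
  have [rD r1 r2] := marker_unstarred v SS.
  by have [w Ew] := marker_onto Dplanar starred S0S rD r1 r2; have := none w; rewrite -Ew eqxx.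
have finj : injective f.
  by move=> u v Ef; apply: (marker_inj SS); rewrite !fP Ef.
by exists (perm finj) => v; rewrite permE.
Qed.

(** * State sums as determinants *)

Section Determinant.
Variable K : fieldType.
Variable S0 : {ffun crossing D -> corner}.
Hypothesis S0S : S0 \in states R1 R2.
Implicit Types wt : crossing D -> corner -> K.

(** The regions are indexed by the crossings through the markers of [S0]. *)
Definition touches v c w : K := (corner_region v c == marker_region S0 w)%:R.

Definition state_matrix wt : 'M[K]_#|crossing D| :=
  \matrix_(i, j) \sum_c wt (enum_val i) c * touches (enum_val i) c (enum_val j).

(** Expanding the determinant and the entries gives a sum over all choices of a
    corner at each crossing; such a choice meets a permutation exactly when it is
    a state, and then only one. *)
Lemma det_state_matrix wt :
  \det (state_matrix wt) =
  \sum_(S in states R1 R2)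
    (-1) ^+ (#|black_holes S0| + #|black_holes S|) * \prod_v wt v (S v).
Proof.
pose G (s : 'S_#|crossing D|) (S : {ffun crossing D -> corner}) : K :=
  \prod_v touches v (S v) (enum_val (s (enum_rank v))).
have expand (s : 'S_#|crossing D|) : \prod_i state_matrix wt i (s i) =
    \sum_(S : {ffun crossing D -> corner}) (\prod_v wt v (S v)) * G s S.
  rewrite (reindex (@enum_rank (crossing D))) /=; last exact/onW_bij/enum_rank_bij.
  under eq_bigr do rewrite mxE enum_rankK.
  rewrite bigA_distr_bigA /=; apply: eq_bigr => S _.
  by rewrite /G -big_split.
rewrite /determinant; under eq_bigr do rewrite expand mulr_sumr.
rewrite exchange_big [RHS]big_mkcond /=; apply: eq_bigr => S _.
have Gnz s : G s S != 0 ->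
    forall v, marker_region S v = marker_region S0 (enum_val (s (enum_rank v))).
  move=> /prodf_neq0 nz v; have := nz v isT.
  by rewrite /touches; case: (corner_region _ _ =P _); rewrite ?eqxx.
case: ifP => SS; last first.
  apply: big1 => s _; have [-> | /Gnz GS] := eqVneq (G s S) 0; first by rewrite !mulr0.
  case/negP: SS; rewrite inE; apply/andP; split.
    apply/forallP => v; rewrite GS.
    by have [_ -> ->] := marker_unstarred (enum_val (s (enum_rank v))) S0S.
  apply/injectiveP => u v; rewrite !GS => /(marker_inj S0S) /enum_val_inj /perm_inj.
  exact: enum_rank_inj.
have [sg sgP] := state_perm S0S SS.
have finj : injective (fun i : 'I_#|crossing D| => enum_rank (sg (enum_val i))).
  by move=> i j /enum_rank_inj /perm_inj /enum_val_inj.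
pose s0 : 'S_#|crossing D| := perm finj.
have s0P v : s0 (enum_rank v) = enum_rank (sg v) by rewrite permE enum_rankK.
rewrite (bigD1 s0) //= [X in _ + X]big1 ?addr0 => [|s ss0]; last first.
  have [-> | /Gnz GS] := eqVneq (G s S) 0; first by rewrite !mulr0.
  case/eqP: ss0; apply/permP => i; rewrite -[i]enum_valK s0P.
  by apply: enum_val_inj; rewrite enum_rankK; apply: (marker_inj S0S); rewrite -GS sgP.
have -> : G s0 S = 1.
  apply: big1 => v _; rewrite /touches s0P enum_rankK.
  by rewrite -[corner_region _ _]/(marker_region S v) sgP eqxx.
rewrite mulr1; congr (_ * _); rewrite -[RHS]signr_odd -(black_holes_perm S0S SS sgP).
by rewrite (odd_perm_conj (enum_rank_bij _) s0P).
Qed.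

Definition hole_weight (a b : crossing D -> K) v c : K :=
  match c with OutCorner => a v | InCorner => b v | _ => 1 end.

Definition hole_difference : 'M[K]_#|crossing D| :=
  \matrix_(i, j) (touches (enum_val i) OutCorner (enum_val j) -
                  touches (enum_val i) InCorner (enum_val j)).

Lemma sum_enum_val (F : crossing D -> K) :
  \sum_(i < #|crossing D|) F (enum_val i) = \sum_v F v.
Proof. exact/esym/(big_enum_val F). Qed.

Let side e h w : K := (region_of (e, h) == marker_region S0 w)%:R.
Let side_in v h h' w :=
  congr1 (fun r => (r == marker_region S0 w)%:R : K) (region_of_in v h h').
Let side_out v h h' w :=
  congr1 (fun r => (r == marker_region S0 w)%:R : K) (region_of_out v h h').

(** Apply [sum_in_out] to the right sides of the edges: they lie in the ingoing
    corner and the right corner at the heads, and in the outgoing corner and the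
    right corner at the tails. *)
Lemma holes_symmetric j k :
  \sum_v touches v OutCorner j * touches v OutCorner k =
  \sum_v touches v InCorner j * touches v InCorner k.
Proof.
have := sum_in_out (fun e => side e Right j * side e Right k).
rewrite /side; under eq_bigr do rewrite !side_in.
under [RHS]eq_bigr do rewrite !side_out.
by rewrite !big_split /= => /addIr.
Qed.

(** Apply [sum_in_out] to the products of the two sides of an edge. *)
Lemma holes_skew j k :
  \sum_v ((touches v OutCorner j - touches v InCorner j) *
            (touches v LeftCorner k + touches v RightCorner k) +
          (touches v LeftCorner j + touches v RightCorner j) *
            (touches v OutCorner k - touches v InCorner k)) = 0.
Proof.
have := sum_in_out (fun e => side e Left j * side e Right k + side e Left k * side e Right j).
rewrite /side; under eq_bigr do rewrite !side_in.
under [RHS]eq_bigr do rewrite !side_out.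
move/eqP; rewrite eq_sym -subr_eq0 -sumrB => /eqP eq0; rewrite -[RHS]eq0.
by apply: eq_bigr => v _; rewrite -!/(touches _ _ _); ring.
Qed.

Lemma det_swap_holes (a b : crossing D -> K) m : (forall v, a v + b v = m) ->
  \det (state_matrix (hole_weight b a)) =
  (-1) ^+ \rank hole_difference * \det (state_matrix (hole_weight a b)).
Proof.
move=> abm; apply: (det_skew_partner (X := diag_mx (\row_i (a (enum_val i) - b (enum_val i))))).
  apply/matrixP => j k; rewrite !mxE; apply/eqP; rewrite -addr_eq0 -big_split /=.
  pose j' : crossing D := enum_val j; pose k' : crossing D := enum_val k.
  pose T v c := touches v c j'; pose U v c := touches v c k'.
  pose F v := ((T v OutCorner - T v InCorner) * (U v LeftCorner + U v RightCorner) +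
      (T v LeftCorner + T v RightCorner) * (U v OutCorner - U v InCorner)) +
      m * (T v OutCorner * U v OutCorner - T v InCorner * U v InCorner).
  rewrite (eq_bigr (fun i => F (enum_val i))).
    rewrite (sum_enum_val F) big_split /= holes_skew add0r -mulr_sumr sumrB.
    by rewrite holes_symmetric subrr mulr0.
  move=> i _; rewrite /F !mxE !sum_corner /hole_weight -(abm (enum_val i)).
  by rewrite /T /U; ring.
apply/matrixP => i j; rewrite mul_diag_mx !mxE !sum_corner /hole_weight.
by ring.
Qed.

(** In [det_swap_holes] with the weights 1 and -1, the signs of the state and of
    its black holes cancel in every term on the right, while the terms on the
    left keep the sign (-1)^(black holes + white holes).  Equality of the sums
    forces equality of all the terms in characteristic 0. *)
Lemma hole_parity : (forall k, k%:R = 0 :> K -> k = 0%N) ->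
  forall S, S \in states R1 R2 ->
  (-1) ^+ #|white_holes S| =
  (-1) ^+ (\rank hole_difference + #|black_holes S|) :> K.
Proof.
move=> char0.
pose h := \rank hole_difference.
have weight_const a b (S : {ffun crossing D -> corner}) :
    \prod_v hole_weight (fun=> a) (fun=> b) v (S v) =
    a ^+ #|white_holes S| * b ^+ #|black_holes S|.
  rewrite -!prodr_const [X in X * _]big_mkcond [X in _ * X]big_mkcond -big_split /=.
  apply: eq_bigr => v _; rewrite !inE /hole_weight.
  by case: (S v) => /=; rewrite ?mulr1 ?mul1r.
have := det_swap_holes (a := fun=> 1) (b := fun=> -1) (fun=> erefl).
rewrite !det_state_matrix mulr_sumr => /eqP; rewrite eq_sym -subr_eq0 -sumrB => /eqP eq0.
pose N (S : {ffun crossing D -> corner}) := (h + #|black_holes S| + #|white_holes S|)%N.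
have sumN : \sum_(S in states R1 R2) (1 - (-1) ^+ N S) = 0 :> K.
  have := congr1 ( *%R ((-1) ^+ (h + #|black_holes S0|))) eq0.
  rewrite mulr0 mulr_sumr => eq1; rewrite -[RHS]eq1.
  apply: eq_bigr => S _; rewrite !weight_const !expr1n mul1r mulr1 mulrBr.
  rewrite /N -!exprD; congr (_ - _); rewrite -signr_odd !oddD.
    by do 3 case: odd.
  by rewrite -[RHS]signr_odd !oddD; do 4 case: odd.
have even S : S \in states R1 R2 -> ~~ odd (N S).
  have termE T : 1 - (-1) ^+ N T = (2 * odd (N T))%:R :> K.
    by rewrite -signr_odd; case: odd; rewrite ?opprK ?subrr.
  move: sumN; under eq_bigr do rewrite termE.
  rewrite -natr_sum => /char0/eqP; rewrite sum_nat_eq0 => /forall_inP even /even.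
  by case: odd.
move=> S /even; rewrite /N oddD => evenS.
by rewrite -signr_odd -[RHS]signr_odd; congr (_ ^+ _); move: evenS; do 2 case: odd.
Qed.

End Determinant.
End StateSum.
End Diagram.

(** * Equality of the two state sums *)

Lemma natr_frac_eq0 k : k%:R = 0 :> {fraction {poly int}} -> k = 0%N.
Proof.
rewrite -(rmorph_nat (@tofrac {poly int})) => /eqP; rewrite tofrac_eq0.
by rewrite -polyC_natr polyC_eq0 Num.Theory.pnatr_eq0 => /eqP.
Qed.

Theorem theorem2p2 (D : link_diagram) (R1 R2 : {set edge_side D})
  (Dconnected : diagram_connected D) (Dplanar : diagram_planar D)
  (starred : regions_adjacent R1 R2) :
  Theta R1 R2 = nabla R1 R2.
Proof.
have [/set0Pn[S0 S0S] | /negPn/eqP noS] := boolP (states R1 R2 != set0); last first.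
  by rewrite /Theta /nabla noS !big_set0.
pose a (v : crossing D) := ac_label v OutCorner.
pose b (v : crossing D) := ac_label v InCorner.
have swap := det_swap_holes S0 (a := a) (b := b) (m := sqrt_t + sqrt_t^-1).
have ab v : a v + b v = sqrt_t + sqrt_t^-1.
  by rewrite /a /b /=; case: positive; rewrite // addrC.
have parity := hole_parity Dconnected Dplanar starred S0S natr_frac_eq0.
have osE v c : os_label v c = hole_weight b a v c.
  by rewrite /os_label /a /b; case: c => /=; rewrite ?invr1 //; case: positive; rewrite ?invrK.
apply: (can_inj (signrMK (#|black_holes S0|))).
have -> : (-1) ^+ #|black_holes S0| * nabla R1 R2 =
    \det (state_matrix S0 (hole_weight a b)).
  rewrite (det_state_matrix Dconnected Dplanar starred S0S) mulr_sumr.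
  by apply: eq_bigr => S _; rewrite mulrA -exprD; congr (_ * _).
pose h := \rank (hole_difference {fraction {poly int}} S0).
rewrite -[RHS](signrMK h) -(swap ab).
rewrite (det_state_matrix Dconnected Dplanar starred S0S) !mulr_sumr.
apply: eq_bigr => S SS; rewrite parity // !mulrA -!exprD; congr (_ * _).
  by rewrite !addnA [(_ + #|black_holes S0|)%N]addnC.
by rewrite /os_weight; apply: eq_bigr => v _; apply: osE.
Qed.
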